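(* Let $\phi_w:\mathbb{R}^n\times\mathbb{R}^d\to\mathbb{R}^n$ be a state-transition map with $\phi_w(0,0)=0$ that is $\lambda$-contractive in $h$ for some $\lambda\in(0,1)$, i.e. $\|\phi_w(h,x)-\phi_w(h',x)\|\le\lambda\|h-h'\|$ for all $h,h',x$, and $L_x$-Lipschitz in $x$, i.e. $\|\phi_w(h,x)-\phi_w(h,x')\|\le L_x\|x-x'\|$ for all $h,x,x'$, with $L_x>0$. Let the prediction function $f$ on $\mathbb{R}^n$ be $L_f$-Lipschitz with $L_f>0$, and let the inputs satisfy $\|x_t\|\le B_x$ for all $t$, with $B_x>0$. Let $\varepsilon>0$. If the truncation length $k$ satisfies $$k\ge\log_{1/\lambda}\left(\frac{L_fL_xB_x}{(1-\lambda)\varepsilon}\right),$$ then the predictions $y_t=f(h_t)$ of the recurrent model and $y_t^k=f(h_t^k)$ of the truncated model satisfy $\|y_t-y_t^k\|\le\varepsilon$ for all $t$.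
   Context: Norms are Euclidean. The hidden states of the recurrent model on inputs $x_1,x_2,\dots\in\mathbb{R}^d$ are $h_t=\phi_w(h_{t-1},x_t)$ with $h_0=0$. For a nonnegative integer $k$ (the truncation length), the truncated state $h_t^k$ at time $t$ is obtained by running the same recursion $h^k_s=\phi_w(h^k_{s-1},x_s)$ for $s=t-k+1,\dots,t$ started from $h^k_{t-k}=0$; if $t<k$, it is started from state $0$ at time $0$, so $h_t^k=h_t$. *)

(* Defs.v *)
From HB Require Import structures.
From mathcomp Require Import all_boot all_order all_algebra.
From mathcomp Require Import all_classical all_reals all_analysis.
Set Implicit Arguments.
Unset Strict Implicit.
Unset Printing Implicit Defensive.
Import Order.TTheory GRing.Theory Num.Theory.
Local Open Scope ring_scope.

(* The canonical norm `|v| on 'cV[R]_n is the sup norm, hence this definition. *)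
Definition enorm (R : realType) (n : nat) (v : 'cV[R]_n) : R :=
  Num.sqrt (\sum_(i < n) v i 0 ^+ 2).

Definition logb (R : realType) (b z : R) : R := ln z / ln b.

Section Recurrence.
Variables (R : realType) (n d : nat).
Variable phi : 'cV[R]_n -> 'cV[R]_d -> 'cV[R]_n.
(* The inputs are x 1, x 2, ...; the value x 0 is never used. *)
Variable x : nat -> 'cV[R]_d.

(* State at time s + m of the recursion started from the zero state at time
   s, i.e. after consuming x (s + 1), ..., x (s + m). *)
Fixpoint state_from (s m : nat) : 'cV[R]_n :=
  if m is m'.+1 then phi (state_from s m') (x (s + m)%N) else 0.

Definition hidden_state (t : nat) : 'cV[R]_n := state_from 0 t.

(* The start time t - k is a truncated subtraction, so it is 0 when t < k;
   the number of steps is then t, and k otherwise. *)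
Definition truncated_state (k t : nat) : 'cV[R]_n :=
  state_from (t - k)%N (minn k t).

Lemma truncated_state_small k t :
  (t < k)%N -> truncated_state k t = hidden_state t.
Proof.
by move=> /ltnW tk; rewrite /truncated_state (minn_idPr tk) (eqP tk).
Qed.

End Recurrence.

(* Main.v *)
(* Contractivity keeps every state in the ball of radius Lx Bx / (1 - lambda).
   The full and the truncated state at time t are driven by the same last k
   inputs and differ only in their value at time t - k, so they are within
   lambda^k Lx Bx / (1 - lambda) of each other, and the lower bound on k says
   exactly that Lf times this quantity is at most eps. *)
Require Import Defs.
From HB Require Import structures.
From mathcomp Require Import all_boot all_order all_algebra.
From mathcomp Require Import all_classical all_reals all_analysis.
From mathcomp Require Import ring lra.
Set Implicit Arguments.
Unset Strict Implicit.
Unset Printing Implicit Defensive.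
Import Order.TTheory GRing.Theory Num.Theory.
Local Open Scope ring_scope.

Lemma enorm_ge0 (R : realType) (n : nat) (v : 'cV[R]_n) : 0 <= enorm v.
Proof. exact: sqrtr_ge0. Qed.

Lemma enorm0 (R : realType) (n : nat) : enorm (0 : 'cV[R]_n) = 0.
Proof. by rewrite /enorm big1 ?sqrtr0// => i _; rewrite mxE expr0n. Qed.

Lemma sqr_enorm (R : realType) (n : nat) (v : 'cV[R]_n) :
  enorm v ^+ 2 = \sum_(i < n) v i 0 ^+ 2.
Proof. by rewrite sqr_sqrtr// sumr_ge0// => i _; rewrite sqr_ge0. Qed.

Lemma enorm_eq0 (R : realType) (n : nat) (v : 'cV[R]_n) :
  enorm v = 0 -> v = 0.
Proof.
move=> v0; have := sqr_enorm v; rewrite v0 expr0n /= => /esym s0.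
apply/colP => i; rewrite mxE; apply/eqP; rewrite -sqrf_eq0; apply/eqP.
by apply: (psumr_eq0P _ s0) => // j _; rewrite sqr_ge0.
Qed.

Lemma enorm_cauchy_schwarz (R : realType) (n : nat) (u v : 'cV[R]_n) :
  \sum_(i < n) u i 0 * v i 0 <= enorm u * enorm v.
Proof.
have [/enorm_eq0 ->|u0] := eqVneq (enorm u) 0.
  by rewrite enorm0 mul0r big1// => i _; rewrite mxE mul0r.
have [/enorm_eq0 ->|v0] := eqVneq (enorm v) 0.
  by rewrite enorm0 mulr0 big1// => i _; rewrite mxE mulr0.
(* With the zero vectors set aside, both sides may be scaled by [2 * (enorm u * enorm v)], which
   replaces normalising [u] and [v]. *)
have ab0 : 0 < enorm u * enorm v.
  by rewrite mulr_gt0// lt_def enorm_ge0 andbT.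
rewrite -(ler_pM2l ab0) -(ler_pM2l (ltr0n R 2)) !mulr_sumr.
(* AM-GM: 2 |u| |v| u_i v_i <= |v|^2 u_i^2 + |u|^2 v_i^2 *)
apply: (@le_trans _ _ (\sum_(i < n)
    (enorm v ^+ 2 * u i 0 ^+ 2 + enorm u ^+ 2 * v i 0 ^+ 2))).
  apply: ler_sum => i _.
  have := sqr_ge0 (enorm v * u i 0 - enorm u * v i 0); nra.
(* Summed over [i], the AM-GM bounds give exactly twice the square of [enorm u * enorm v]. *)
by rewrite big_split /= -!mulr_sumr -!sqr_enorm; nra.
Qed.

Lemma enormD (R : realType) (n : nat) (u v : 'cV[R]_n) :
  enorm (u + v) <= enorm u + enorm v.
Proof.
rewrite -ler_sqr ?nnegrE ?addr_ge0 ?enorm_ge0// sqrrD !sqr_enorm.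
under eq_bigr do rewrite mxE sqrrD.
rewrite !big_split /= lerD2r lerD2l -mulr2n lerMn2r /=.
exact: enorm_cauchy_schwarz.
Qed.

(** The radius is the fixed point of [r |-> lambda * r + Lx * Bx], the worst growth of the norm in
    one step, so the ball is invariant. *)
Lemma enorm_state_from (R : realType) (n d : nat)
    (phi : 'cV[R]_n -> 'cV[R]_d -> 'cV[R]_n) (x : nat -> 'cV[R]_d)
    (lambda Lx Bx : R) :
  phi 0 0 = 0 -> 0 <= lambda -> lambda < 1 ->
  (forall h h' u, enorm (phi h u - phi h' u) <= lambda * enorm (h - h')) ->
  0 <= Lx ->
  (forall h u u', enorm (phi h u - phi h u') <= Lx * enorm (u - u')) ->
  0 <= Bx -> (forall t, (1 <= t)%N -> enorm (x t) <= Bx) ->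
  forall s j, enorm (state_from phi x s j) <= Lx * Bx / (1 - lambda).
Proof.
move=> phi00 l0 l1 phiC Lx0 phiL Bx0 xB s; elim=> [|j IHj] /=.
  by rewrite enorm0 divr_ge0 ?mulr_ge0// subr_ge0 ltW.
set h := state_from phi x s j; set u := x _.
(* Passing through [phi 0 u] separates the two effects: contraction moves [h] to 0, then the
   Lipschitz bound moves [u] to 0, where [phi 0 0 = 0]. *)
rewrite -[phi h u](subrK (phi 0 u)) (le_trans (enormD _ _))//.
have uB : enorm u <= Bx by apply: xB; rewrite addnS.
have h1 := phiC h 0 u; rewrite subr0 in h1.
have h2 := phiL 0 u 0; rewrite phi00 !subr0 in h2.
have -> : Lx * Bx / (1 - lambda) =
    lambda * (Lx * Bx / (1 - lambda)) + Lx * Bx.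
  by field; rewrite subr_eq0 gt_eqF.
apply: lerD; first exact: le_trans h1 (ler_wpM2l l0 IHj).
exact: le_trans h2 (ler_wpM2l Lx0 uB).
Qed.

(** After time [s + a] both runs read the same inputs, so each step shrinks their gap by [lambda].
    The second run starts there from 0, so the initial gap is the state of the first. *)
Lemma enorm_state_fromB (R : realType) (n d : nat)
    (phi : 'cV[R]_n -> 'cV[R]_d -> 'cV[R]_n) (x : nat -> 'cV[R]_d)
    (lambda : R) :
  0 <= lambda ->
  (forall h h' u, enorm (phi h u - phi h' u) <= lambda * enorm (h - h')) ->
  forall s a j, enorm (state_from phi x s (a + j) - state_from phi x (s + a) j)
    <= lambda ^+ j * enorm (state_from phi x s a).
Proof.
move=> l0 phiC s a; elim=> [|j IHj]; first by rewrite addn0 subr0 mul1r.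
rewrite addnS /= !addnS addnA exprS -mulrA.
exact: le_trans (phiC _ _ _) (ler_wpM2l l0 IHj).
Qed.

Lemma logb_le_nat (R : realType) (b z : R) (k : nat) :
  1 < b -> 0 < z -> logb b z <= k%:R -> z <= b ^+ k.
Proof.
move=> b1 z0; have b0 : 0 < b := lt_trans ltr01 b1.
rewrite /logb ler_pdivrMr ?ln_gt0// mulr_natl -lnXn// ler_ln//.
by rewrite posrE exprn_gt0.
Qed.

Theorem proposition3 (R : realType) (n d m : nat)
  (phi : 'cV[R]_n -> 'cV[R]_d -> 'cV[R]_n) (f : 'cV[R]_n -> 'cV[R]_m)
  (x : nat -> 'cV[R]_d) (lambda Lx Lf Bx eps : R) (k : nat)
  (phi00 : phi 0 0 = 0)
  (lambda_gt0 : 0 < lambda) (lambda_lt1 : lambda < 1)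
  (phi_contractive : forall (h h' : 'cV[R]_n) (u : 'cV[R]_d),
     enorm (phi h u - phi h' u) <= lambda * enorm (h - h'))
  (Lx_gt0 : 0 < Lx)
  (phi_lipschitz : forall (h : 'cV[R]_n) (u u' : 'cV[R]_d),
     enorm (phi h u - phi h u') <= Lx * enorm (u - u'))
  (Lf_gt0 : 0 < Lf)
  (f_lipschitz : forall h h' : 'cV[R]_n,
     enorm (f h - f h') <= Lf * enorm (h - h'))
  (Bx_gt0 : 0 < Bx)
  (x_bounded : forall t : nat, (1 <= t)%N -> enorm (x t) <= Bx)
  (eps_gt0 : 0 < eps)
  (k_large : logb lambda^-1 (Lf * Lx * Bx / ((1 - lambda) * eps)) <= k%:R) :
  forall t : nat,
    enorm (f (hidden_state phi x t) - f (truncated_state phi x k t)) <= eps.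
Proof.
move=> t; have [tk|kt] := ltnP t k.
  by rewrite truncated_state_small// subrr enorm0 ltW.
apply: le_trans (f_lipschitz _ _) _.
rewrite /hidden_state /truncated_state (minn_idPl kt).
(* The full run is cut at time [t - k], where the truncated one starts; [kt] makes the two pieces
   add up to [t]. *)
have := enorm_state_fromB x (ltW lambda_gt0) phi_contractive 0 (t - k) k.
rewrite subnK// add0n => diff_le.
have state_le := enorm_state_from phi00 (ltW lambda_gt0) lambda_lt1
  phi_contractive (ltW Lx_gt0) phi_lipschitz (ltW Bx_gt0) x_bounded 0 (t - k).
have ol0 : 0 < 1 - lambda by rewrite subr_gt0.
have z_gt0 : 0 < Lf * Lx * Bx / ((1 - lambda) * eps).
  by rewrite divr_gt0 ?mulr_gt0.
have := logb_le_nat _ z_gt0 k_large; rewrite invf_gt1// => /(_ lambda_lt1).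
(* The base [lambda^-1] turns the bound on [k] into: the argument of the logarithm times
   [lambda ^+ k] is at most 1. *)
rewrite exprVn -[leRHS]mul1r ler_pdivlMr ?exprn_gt0// => z_le.
apply: (@le_trans _ _
    (Lf * (lambda ^+ k * (Lx * Bx / (1 - lambda))))).
  rewrite ler_pM2l//; apply: le_trans diff_le _.
  by rewrite ler_pM2l ?exprn_gt0.
(* Factoring out [eps] exposes the product bounded by [z_le]. *)
have -> : Lf * (lambda ^+ k * (Lx * Bx / (1 - lambda))) =
    eps * (Lf * Lx * Bx / ((1 - lambda) * eps) * lambda ^+ k).
  by field; rewrite !gt_eqF.
by rewrite -[leRHS]mulr1 ler_pM2l.
Qed.
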